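(* Let $A\geq a\geq 1$ and $r\geq 2$ be integers, and let $O\widetilde{mes}_{r,A,a}$ be the set of overpartitions $\pi$ such that all parts of $\pi$ of size $\equiv a\pmod A$ and less than $\widetilde{mes}_{r,A,a}(\pi)$ are overlined. Then \[ \sum_{\pi \in O\widetilde{mes}_{r,A,a}}z^{\widetilde{mes}_{r,A,a}(\pi)}q^{|\pi|} =\frac{(-q;q)_{\infty }}{(q;q)_{\infty}}\sum_{k=0}^{\infty }z^{kA+a}\bigg[q^{A\binom{k}{2}+ka}\frac{(q^{a};q^{A})_{k}}{(-q^{a};q^{A})_{k+1 }}-q^{A\binom{k}{2}+ka+(r-1)(kA+a)}\frac{(q^{a};q^{A})_{k}}{(-q^{a};q^{A})_{k+1}}\bigg]. \]
   Context: An overpartition is a partition (finite non-increasing sequence of positive integers) in which the first occurrence of each part value may be overlined; $|\pi|$ is the sum of parts. A part is of size $t$ if it equals $t$ or $\overline{t}$. $(a;q)_\infty=\prod_{i\geq0}(1-aq^i)$, $(a;q)_n=(a;q)_\infty/(aq^n;q)_\infty$; $|q|<1$, $z$ a formal variable. For $r\geq2$, $\widetilde{mes}_{r,A,a}(\pi)$ is the smallest positive integer $m\equiv a\pmod A$ such that $\pi$ has no overlined part $\overline{m}$ and $\pi$ has fewer than $r-1$ non-overlined parts equal to $m$. *)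

(* Defs.v *)
From HB Require Import structures.
From mathcomp Require Import all_boot all_order all_algebra.
From mathcomp Require Import finmap.
From mathcomp Require Import all_classical all_reals all_analysis.
From mathcomp.analysis.showcase Require summability.
From mathcomp.real_closed Require Export complex.

Set Implicit Arguments.
Unset Strict Implicit.
Unset Printing Implicit Defensive.

Import Order.TTheory GRing.Theory Num.Theory.
Import numFieldNormedType.Exports.

Local Open Scope ring_scope.
Local Open Scope classical_set_scope.

(* A part is a pair (size, overlined?).  The [pairwise] clause says that an
   overlined part differs in size from every part that precedes it. *)
Definition is_overpartition (s : seq (nat * bool)) : bool :=
  [&& sorted geq (map fst s), all (fun x => 0 < x.1)%N s &
      pairwise (fun x y : nat * bool => y.2 ==> (x.1 != y.1)) s].

Record overpartition := Overpartition {
  parts :> seq (nat * bool);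
  _ : is_overpartition parts }.

HB.instance Definition _ := [isSub for parts].
HB.instance Definition _ := [Countable of overpartition by <:].

Definition op_weight (p : overpartition) : nat := sumn (map fst p).

Definition mes_cond (r A a : nat) (p : overpartition) (m : nat) : bool :=
  [&& (0 < m)%N, m == a %[mod A], (m, true) \notin parts p &
      (count_mem (m, false) p < r - 1)%N].

Lemma mes_cond_ex (r A a : nat) (p : overpartition) :
  (0 < A)%N -> (1 < r)%N -> exists m, mes_cond r A a p m.
Proof.
move=> A0 r1; exists ((op_weight p).+1 * A + a)%N.
set m := (_ + a)%N; have wm : (op_weight p < m)%N.
  by rewrite (leq_trans _ (leq_addr _ _)) // leq_pmulr.
have mP b : (m, b) \notin parts p.
  apply/negP => mp; move: wm; rewrite ltnNge => /negP; apply.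
  rewrite /op_weight sumnE big_map (big_rem _ mp) /=.
  exact: leq_addr.
rewrite /mes_cond mP (count_memPn (mP false)) subn_gt0 r1 /m modnMDl eqxx.
by rewrite (leq_ltn_trans _ wm).
Qed.

(* The default value 0 is never taken when 0 < A and 1 < r, by [mes_cond_ex]. *)
Definition mes (r A a : nat) (p : overpartition) : nat :=
  if pselect (exists m, mes_cond r A a p m) is left h then ex_minn h else 0%N.

Lemma mesP (r A a : nat) (p : overpartition) :
  (0 < A)%N -> (1 < r)%N ->
  mes_cond r A a p (mes r A a p) /\
  (forall m, mes_cond r A a p m -> (mes r A a p <= m)%N).
Proof.
move=> A0 r1; rewrite /mes; case: pselect => [h|/(_ (mes_cond_ex a p A0 r1))//].
by case: ex_minnP.
Qed.

Definition Omes (r A a : nat) (p : overpartition) : bool :=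
  all (fun x => (x.1 == a %[mod A]) && (x.1 < mes r A a p)%N ==> x.2) (parts p).

Section qseries.
Variable K : numFieldType.
Implicit Types (x q : K) (n : nat).

Definition qpoch_inf x q : K := limn (fun n => \prod_(i < n) (1 - x * q ^+ i)).

Definition qpoch x q n : K := qpoch_inf x q / qpoch_inf (x * q ^+ n) q.

(* Formal power series in z over K, given by their coefficients. *)
Definition zseries := nat -> K.

Definition zmonom (c : K) (m : nat) : zseries :=
  fun n => if n == m then c else 0.

Definition zscale (c : K) (f : zseries) : zseries := fun n => c * f n.

(* Infinite sums of formal power series are taken coefficientwise; each
   coefficient is an unconditional sum, i.e. the limit of the finite partial
   sums along the directed set of finite subsets of the index type. *)
Definition zsummable (I : choiceType) (f : I -> zseries) : Prop :=
  forall n, cvg (summability.partial_sum (fun i => f i n) @ summability.totally).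

Definition zsum (I : choiceType) (f : I -> zseries) : zseries :=
  fun n => summability.sum (fun i => f i n : K).

End qseries.

(* Main.v *)
Require Import Defs.
From mathcomp Require Import all_boot all_order all_algebra.
From mathcomp Require Import finmap zify ring.
From mathcomp Require Import all_classical all_reals all_analysis.

(** Let [m = k A + a].  An overpartition lies in the class and has [mes] equal
    to [m] iff every size [j A + a] with [j < k] occurs exactly once, overlined,
    and the size [m] occurs fewer than [r - 1] times, never overlined; the other
    sizes are free.  Such overpartitions with parts at most [N] and free
    multiplicities below [N] are therefore counted exactly by a finite product.
    It differs from a partial product of the right-hand side only by factors
    [1 - q ^ (i N)], whose product tends to 1 as [N] grows.  The same limit for
    [|q|] gives absolute summability, so this exhaustion computes the
    unconditional sum. *)

Set Implicit Arguments.
Unset Strict Implicit.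
Unset Printing Implicit Defensive.

Import Order.TTheory GRing.Theory Num.Theory.
Import numFieldNormedType.Exports.

Local Open Scope ring_scope.
Local Open Scope classical_set_scope.

(** * Unconditional sums *)

Lemma big_seq_subset (V : Type) (idx : V) (op : Monoid.com_law idx) (I : eqType)
    (s t : seq I) (g : I -> V) : uniq s -> uniq t -> {subset s <= t} ->
  \big[op/idx]_(i <- t) g i =
    op (\big[op/idx]_(i <- s) g i) (\big[op/idx]_(i <- t | i \notin s) g i).
Proof.
move=> us ut st; rewrite (bigID (mem s)) /=; congr (op _ _).
rewrite -big_filter; apply: perm_big; apply: uniq_perm; rewrite ?filter_uniq //.
by move=> i; rewrite mem_filter; apply: andb_idr => /st.
Qed.

Lemma ler_sum_seq_support (K : numDomainType) (I : eqType) (s t : seq I) (g : I -> K) :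
  uniq s -> uniq t -> (forall i, 0 <= g i) ->
  (forall i, i \in s -> g i != 0 -> i \in t) ->
  \sum_(i <- s) g i <= \sum_(i <- t) g i.
Proof.
move=> us ut g0 st; rewrite (bigID (fun i => g i != 0)) /= addrC big1 ?add0r; last first.
  by move=> i; rewrite negbK => /eqP.
rewrite -big_filter (@big_seq_subset _ _ _ _ [seq i <- s | g i != 0] t) ?filter_uniq //.
  by rewrite lerDl; apply: sumr_ge0.
by move=> i; rewrite mem_filter => /andP[gi si]; exact: st.
Qed.

Local Existing Instance summability.totally_filter.

(** The lists [F n] need not be nested. A finite [J] containing [F N] has its support inside some
    later [F N'], so the absolute sum over [J] outside [F N] is at most a difference of two absolute
    sums, both close to [l']. *)
Lemma cvg_partial_sum_exhaust (K : numFieldType) (I : choiceType) (f : I -> K)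
    (F : nat -> seq I) (l l' : K) :
  (forall n, uniq (F n)) ->
  (forall i, f i != 0 -> \forall n \near \oo, i \in F n) ->
  (fun n => \sum_(i <- F n) f i) @ \oo --> l ->
  (fun n => \sum_(i <- F n) `|f i|) @ \oo --> l' ->
  summability.partial_sum f @ summability.totally --> l.
Proof.
move=> uF exF /cvgrPdist_le cl /cvgrPdist_le cl'.
apply/cvgrPdist_le => e e0; have e30 : 0 < e / 3 by rewrite divr_gt0.
have [N _ hN] := filterI (cl _ e30) (cl' _ e30).
have [hl hl'] := hN N (leqnn N).
exists [fset i in F N]%fset => //= J /fsubsetP FJ.
have {}FJ : {subset F N <= J} by move=> i iF; apply: FJ; rewrite inE.
have [N' NN' exJ] : exists2 N', (N <= N')%N &
    forall i, i \in (J : seq I) -> `|f i| != 0 -> i \in F N'.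
  have : \forall n \near \oo, forall i, i \in (J : seq I) -> f i != 0 -> i \in F n.
    elim: (J : seq I) => [|j s IH]; first by near=> n.
    have jF : \forall n \near \oo, f j != 0 -> j \in F n.
      by have [_|/exF] := eqVneq (f j) 0; [near=> n|apply: filterS].
    apply: filterS2 jF IH => n jn IHn i; rewrite inE => /orP[/eqP->//|]; exact: IHn.
  move=> [M _ hM]; exists (maxn N M); first exact: leq_maxl.
  by move=> i iJ; rewrite normr_eq0; apply: hM => //=; exact: leq_maxr.
have [_ hl2] := hN N' NN'.
have uJ : uniq J := fset_uniq J.
rewrite /summability.partial_sum.
rewrite -(big_seq_fsetE _ _ predT f) /= (big_seq_subset _ _ (uF N) uJ FJ) /=.
have tail : \sum_(i <- J | i \notin F N) `|f i| <= e / 3 + e / 3.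
  have := ler_sum_seq_support uJ (uF N') (fun i => normr_ge0 (f i)) exJ.
  rewrite (big_seq_subset _ _ (uF N) uJ FJ) /= addrC -lerBrDr => /le_trans; apply.
  rewrite -[X in X - _](subrK l') -addrA.
  apply: le_trans (lerD _ _); last exact: hl'.
    2: by rewrite -normrN opprB in hl2; exact: hl2.
  (* The order on [K] is only partial, so this difference of sums is bounded by its norm once it is
     known to be real. *)
  apply: le_trans (real_ler_norm _) (ler_normD _ _).
  by rewrite addrA subrK; apply: rpredB; apply: sum_real => i _; exact: normr_real.
rewrite opprD addrA (le_trans (ler_normB _ _)) //.
rewrite (le_trans (lerD hl (le_trans (ler_norm_sum _ _ _) tail))) //.
by have -> : e / 3 + (e / 3 + e / 3) = e by field.
Unshelve. all: by end_near.
Qed.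

Lemma cvg_partial_sum1 (K : numFieldType) (I : choiceType) (f : I -> K) (j : I) :
  (forall i, i != j -> f i = 0) ->
  summability.partial_sum f @ summability.totally --> f j.
Proof.
move=> f0; apply: (@cvg_partial_sum_exhaust _ _ f (fun=> [:: j]) _ `|f j|) => //.
- move=> i fi; exists 0%N => // n _ /=; rewrite inE.
  by apply: contraNT fi => /f0 ->.
- by under eq_fun do rewrite big_seq1; exact: cvg_cst.
- by under eq_fun do rewrite big_seq1; exact: cvg_cst.
Qed.

Lemma cvg_partial_sum0 (K : numFieldType) (I : choiceType) (f : I -> K) :
  (forall i, f i = 0) ->
  summability.partial_sum f @ summability.totally --> (0 : K).
Proof.
move=> f0; apply: (@cvg_partial_sum_exhaust _ _ f (fun=> [::]) _ 0) => //.
- by move=> i; rewrite f0 eqxx.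
- by under eq_fun do rewrite big_nil; exact: cvg_cst.
- by under eq_fun do rewrite big_nil; exact: cvg_cst.
Qed.

(** * Infinite products *)

Section complex_limits.
Variable R : realType.
Local Notation C := (R[i] : numFieldType).

Lemma normc_le_ReIm (z : R[i]) : `|z| <= (`|complex.Re z| + `|complex.Im z|)%:C%C.
Proof.
rewrite normc_def lecR.
rewrite -(ger0_norm (addr_ge0 (normr_ge0 (complex.Re z)) (normr_ge0 (complex.Im z)))).
rewrite -sqrtr_sqr ler_wsqrtr // sqrrD !real_normK ?num_real //.
by rewrite addrAC lerDl mulrn_wge0 // mulr_ge0.
Qed.

Lemma norm_Re_le (z : R[i]) (x : R) : `|z| <= x%:C%C -> `|complex.Re z| <= x.
Proof.
rewrite normc_def lecR; apply: le_trans.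
by rewrite -sqrtr_sqr ler_wsqrtr // lerDl sqr_ge0.
Qed.

Lemma norm_Im_le (z : R[i]) (x : R) : `|z| <= x%:C%C -> `|complex.Im z| <= x.
Proof.
rewrite normc_def lecR; apply: le_trans.
by rewrite -sqrtr_sqr ler_wsqrtr // lerDr sqr_ge0.
Qed.

Lemma cvg_complex (u : nat -> C) (x y : R) :
  (fun n => complex.Re (u n)) @ \oo --> x ->
  (fun n => complex.Im (u n)) @ \oo --> y ->
  u @ \oo --> (Complex x y : C).
Proof.
move=> /cvgrPdist_le cx /cvgrPdist_le cy; apply/cvgrPdist_le => e e0.
have eE : e = (complex.Re e)%:C%C by rewrite RRe_real // gtr0_real.
have e20 : 0 < complex.Re e / 2.
  by move: e0; rewrite eE ltcR => ?; rewrite divr_gt0.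
apply: filterS2 (cx _ e20) (cy _ e20) => n hx hy.
apply: le_trans (normc_le_ReIm _) _; rewrite eE lecR.
rewrite (splitr (complex.Re e)); move: hx hy.
by case: (u n) => a b /= hx hy; exact: lerD.
Qed.

(** Completeness of [R] enters here: by comparison with a geometric series, the telescoping series
    converges absolutely. *)
Lemma cvg_geometric_increments (v : R ^nat) (c s : R) : 0 <= s < 1 ->
  (forall n, `|v n.+1 - v n| <= c * s ^+ n) -> cvgn v.
Proof.
move=> /andP[s0 s1] h.
have -> : v = cst (v 0%N) \+ series (telescope v).
  by apply/funext => n; rewrite [LHS]eq_sum_telescope.
apply: is_cvgD; first exact: is_cvg_cst.
apply: normed_cvg; apply: (@series_le_cvg _ _ (geometric c s)) => //=.
- by move=> n; exact: le_trans (normr_ge0 _) (h n).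
- by apply: is_cvg_geometric_series; rewrite ger0_norm.
Qed.

(** By [1 + x <= expR x], the partial products are bounded by the exponential of a geometric sum.
    Their increments [P n * u n] therefore decay geometrically, and real and imaginary parts
    converge separately. *)
Lemma is_cvg_prod_complex (u : nat -> C) (c s : R) : 0 <= c -> 0 <= s < 1 ->
  (forall n, `|u n| <= (c * s ^+ n)%:C%C) ->
  cvgn (fun n => \prod_(i < n) (1 + u i) : C).
Proof.
move=> c0 s01 hu; set P := fun n => _.
have [s0 s1] := andP s01.
pose M := expR (c / (1 - s)).
have Pb n : `|P n| <= M%:C%C.
  apply: (@le_trans _ _ (\prod_(i < n) expR (c * s ^+ i))%:C%C).
    rewrite /P normr_prod rmorph_prod /=; apply: ler_prod => i _.
    rewrite normr_ge0 /= (le_trans (ler_normD _ _)) // normr1.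
    rewrite (le_trans (lerD (lexx _) (hu i))) //.
    by rewrite -(rmorph1 (real_complex R)) -rmorphD /= lecR expR_ge1Dx.
  rewrite lecR -expR_sum ler_expR -mulr_sumr ler_wpM2l //.
  rewrite -[leRHS]mul1r ler_pdivlMr ?subr_gt0 // mulrC -opprB mulNr -subrX1.
  by rewrite opprB gerBl exprn_ge0.
have Pd n : `|P n.+1 - P n| <= (M * c * s ^+ n)%:C%C.
  rewrite /P big_ord_recr /= mulrDr mulr1 addrC addKr normrM.
  rewrite -mulrA rmorphM.
  exact: (ler_pM (normr_ge0 _) (normr_ge0 _) (Pb n) (hu n)).
have cRe : cvgn (fun n => complex.Re (P n)).
  apply: (@cvg_geometric_increments _ (M * c) s) => // n.
  by have := norm_Re_le (Pd n); rewrite raddfB.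
have cIm : cvgn (fun n => complex.Im (P n)).
  apply: (@cvg_geometric_increments _ (M * c) s) => // n.
  by have := norm_Im_le (Pd n); rewrite raddfB.
by apply/cvg_ex; eexists; apply: cvg_complex cRe cIm.
Qed.
End complex_limits.

(* The only consequence of completeness that is needed. *)
Definition geometric_prods_cvg (K : numFieldType) : Prop :=
  forall (u : nat -> K) (c s : K), 0 <= c -> 0 <= s < 1 ->
    (forall n, `|u n| <= c * s ^+ n) -> cvgn (fun n => \prod_(i < n) (1 + u i)).

Lemma complex_geometric_prods_cvg (R : realType) : geometric_prods_cvg R[i].
Proof.
move=> u c s c0 /andP[s0 s1] hu.
have cE : (complex.Re c)%:C%C = c by rewrite RRe_real // ger0_real.
have sE : (complex.Re s)%:C%C = s by rewrite RRe_real // ger0_real.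
apply: (@is_cvg_prod_complex _ u (complex.Re c) (complex.Re s)).
- by rewrite -ler0c cE.
- by rewrite -ler0c sE s0 -ltcR sE.
- by move=> n; rewrite rmorphM rmorphXn /= cE sE.
Qed.

(** * Limits of products and q-Pochhammer symbols *)

Section products.
Variable K : numFieldType.
Hypothesis prods_cvg : geometric_prods_cvg K.
Implicit Types (q s x : K).

Lemma prod1D_ge1 (x : nat -> K) n : (forall i, 0 <= x i) -> 1 <= \prod_(i < n) (1 + x i).
Proof.
move=> x0; elim: n => [|n IH]; first by rewrite big_ord0.
by rewrite big_ord_recr /= mulr_ege1 // lerDl.
Qed.

(* The partial products of [1 + s ^+ i] have increments at least [s ^+ n]. *)
Lemma cvg_expr0 s : 0 <= s < 1 -> (fun n => s ^+ n) @ \oo --> 0.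
Proof.
move=> s01; have [s0 s1] := andP s01.
have := @prods_cvg (fun i => s ^+ i) 1 s ler01 s01.
set P := fun n => _; case/(_ _)/cvg_ex.
  by move=> n; rewrite mul1r ger0_norm // exprn_ge0.
move=> l cP; have cP' : (fun n => P n.+1) @ \oo --> l by rewrite cvg_shiftS.
have /cvgrPdist_le c0 : (fun n => P n.+1 - P n) @ \oo --> 0.
  by rewrite -(subrr l); exact: cvgB cP' cP.
apply/cvgrPdist_le => e /c0; apply: filterS => n; apply: le_trans.
rewrite !sub0r !normrN /P big_ord_recr /= mulrDr mulr1 addrC addKr normrM.
have P1 : 1 <= \prod_(i < n) (1 + s ^+ i) by apply: prod1D_ge1 => i; rewrite exprn_ge0.
by rewrite ler_peMl // ger0_norm // (le_trans ler01).
Qed.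

Lemma prod1D_bounded s : 0 <= s < 1 ->
  exists2 M, 0 <= M & forall n, \prod_(i < n) (1 + s ^+ i) <= M.
Proof.
move=> s01; have [s0 s1] := andP s01.
have := @prods_cvg (fun i => s ^+ i) 1 s ler01 s01.
case/(_ _)/cvg_seq_bounded.
  by move=> n; rewrite mul1r ger0_norm // exprn_ge0.
(* Boundedness means that every number above the real [M] is a bound; [|M| + 1] is one, and it is
   nonnegative. *)
move=> M [Mr hM]; exists (`|M| + 1); first exact: addr_ge0.
move=> n; have P0 : 0 <= \prod_(i < n) (1 + s ^+ i).
  by apply: prodr_ge0 => i _; rewrite addr_ge0 ?exprn_ge0.
rewrite -(ger0_norm P0); apply: (hM (`|M| + 1)) => //.
by rewrite (le_lt_trans (real_ler_norm Mr)) // ltrDl.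
Qed.

(* The map sending [t] to the product of the [1 + t x i] is convex, hence below its chord on [0, 1]. *)
Lemma norm_prod1D_sub1 (d x : nat -> K) (t : K) n : 0 <= t <= 1 ->
  (forall i, 0 <= x i) -> (forall i, `|d i| <= t * x i) ->
  `|\prod_(i < n) (1 + d i) - 1| <= t * (\prod_(i < n) (1 + x i) - 1).
Proof.
move=> /andP[t0 t1] x0 dx; elim: n => [|n IH]; first by rewrite !big_ord0 !subrr normr0 mulr0.
rewrite !big_ord_recr /=; set P := \prod_(i < n) (1 + d i) in IH *.
have := @prod1D_ge1 x n x0.
set Q := \prod_(i < n) (1 + x i) in IH * => Q1.
have -> : P * (1 + d n) - 1 = (P - 1) * (1 + d n) + d n by ring.
apply: le_trans (ler_normD _ _) _; rewrite normrM.
have -> : t * (Q * (1 + x n) - 1) = t * (Q - 1) * (1 + x n) + t * x n by ring.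
apply: lerD => //; apply: ler_pM => //.
apply: le_trans (ler_normD _ _) _; rewrite normr1 lerD2l (le_trans (dx n)) //.
by rewrite ler_piMl.
Qed.

(** The factors themselves change with [N]. The chord bound with [t = s ^+ N] keeps the product
    within [s ^+ N * M] of 1, where [M] bounds all products of the [1 + s ^+ i]. *)
Lemma cvg_prod_near1 s (d : nat -> nat -> K) : 0 <= s < 1 ->
  (forall N i, (0 < N)%N -> `|d N i| <= s ^+ N * s ^+ i) ->
  (fun N => \prod_(i < N) (1 + d N i)) @ \oo --> (1 : K).
Proof.
move=> s01 hd; have [s0 s1] := andP s01.
have [M M0 hM] := prod1D_bounded s01.
have /cvgrPdist_le c0 : (fun n => s ^+ n * M) @ \oo --> 0.
  by rewrite -(mul0r M); apply: cvgM; [exact: cvg_expr0 | exact: cvg_cst].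
apply/cvgrPdist_le => e e0.
have N0 : \forall N \near \oo, (0 < N)%N by exists 1%N.
apply: filterS2 (c0 e e0) N0 => N hN {}N0; apply: le_trans hN.
rewrite distrC sub0r normrN [leRHS]ger0_norm ?mulr_ge0 ?exprn_ge0 //.
apply: le_trans (@norm_prod1D_sub1 (d N) (fun i => s ^+ i) (s ^+ N) N _ _ _) _.
- by rewrite exprn_ge0 // exprn_ile1 // ltW.
- by move=> i; rewrite exprn_ge0.
- by move=> i; exact: hd.
- rewrite ler_wpM2l ?exprn_ge0 // (le_trans _ (hM N)) // gerBl; exact: ler01.
Qed.

Lemma cvg_qpoch_inf x q : `|q| < 1 ->
  (fun n => \prod_(i < n) (1 - x * q ^+ i)) @ \oo --> qpoch_inf x q.
Proof.
move=> q1; apply: (@prods_cvg (fun i => - (x * q ^+ i)) `|x| `|q|) => //.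
  by rewrite normr_ge0.
by move=> n; rewrite normrN normrM normrX.
Qed.

Lemma subr1_neq0 x : `|x| < 1 -> 1 - x != 0.
Proof. by move=> x1; rewrite subr_eq0; apply: contraTneq x1 => <-; rewrite normr1 ltxx. Qed.

(* The partial products of the inverses converge as well, and the two limits multiply to 1. *)
Lemma qpoch_inf_neq0 x q : `|x| < 1 -> `|q| < 1 -> qpoch_inf x q != 0.
Proof.
move=> x1 q1.
have xq i : `|x * q ^+ i| <= `|x|.
  by rewrite normrM normrX ler_piMr // exprn_ile1 // ltW.
have nz i : 1 - x * q ^+ i != 0 by apply: subr1_neq0; exact: le_lt_trans (xq i) x1.
pose u i := (1 - x * q ^+ i)^-1 - 1.
have uE i : 1 + u i = (1 - x * q ^+ i)^-1 by rewrite /u addrC subrK.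
have /cvg_ex[l cl] : cvgn (fun n => \prod_(i < n) (1 + u i)).
  (* Here [u n = x q^n / (1 - x q^n)], and the denominator has norm at least [1 - |x|]. *)
  apply: (@prods_cvg u (`|x| / (1 - `|x|)) `|q|).
  - by rewrite divr_ge0 // subr_ge0 ltW.
  - by rewrite normr_ge0.
  move=> n; have -> : u n = x * q ^+ n / (1 - x * q ^+ n) by rewrite /u; field.
  rewrite normrM normrM normfV normrX mulrAC ler_wpM2r ?exprn_ge0 // ler_wpM2l //.
  rewrite lef_pV2 ?posrE ?subr_gt0 ?normr_gt0 //.
  rewrite -{1}(normr1 K); apply: le_trans (lerB_dist _ _); rewrite lerD2l lerN2; exact: xq.
have c1 : (fun=> 1 : K) @ \oo --> qpoch_inf x q * l.
  have -> : (fun=> 1) = (fun n => \prod_(i < n) (1 - x * q ^+ i) * \prod_(i < n) (1 + u i)).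
    by apply/funext => n; rewrite -big_split big1 //= => i _; rewrite uE mulfV.
  by apply: cvgM cl; exact: cvg_qpoch_inf.
have h1 : qpoch_inf x q * l = 1.
  by apply: (@cvg_unique _ (@norm_hausdorff _ K) _ _ _ _ c1); exact: cvg_cst.
by apply/negP => /eqP h0; move/eqP: h1; rewrite h0 mul0r eq_sym oner_eq0.
Qed.

(** Splitting the first [n] factors off the partial products and passing to the limit factors
    [qpoch_inf x q]; the remaining infinite product is nonzero and cancels. *)
Lemma qpochE x q n : `|x| < 1 -> `|q| < 1 ->
  qpoch x q n = \prod_(i < n) (1 - x * q ^+ i).
Proof.
move=> x1 q1; have xn1 : `|x * q ^+ n| < 1.
  by rewrite normrM normrX (le_lt_trans _ x1) // ler_piMr // exprn_ile1 // ltW.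
rewrite /qpoch; apply: (canLR (mulfK (qpoch_inf_neq0 xn1 q1))).
apply: (@cvg_unique _ (@norm_hausdorff _ K) _ _ _ _ (@cvg_qpoch_inf x q q1)).
suff : (fun N => \prod_(i < N + n) (1 - x * q ^+ i)) @ \oo -->
    (\prod_(i < n) (1 - x * q ^+ i) * qpoch_inf (x * q ^+ n) q : K).
  by rewrite (cvg_shiftn n (fun N => \prod_(i < N) (1 - x * q ^+ i))).
have -> : (fun N => \prod_(i < N + n) (1 - x * q ^+ i)) = (fun N =>
    \prod_(i < n) (1 - x * q ^+ i) * \prod_(i < N) (1 - x * q ^+ n * q ^+ i)).
  apply/funext => N; rewrite addnC big_split_ord /=; congr (_ * _).
  by apply: eq_bigr => i _; rewrite exprD mulrA.
by apply: cvgM; [exact: cvg_cst | exact: cvg_qpoch_inf].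
Qed.
End products.

(** * Overpartitions with prescribed multiplicities *)

(* A multiplicity is a pair (number of non-overlined copies, overlined?); the
   overlined copy comes first, as [is_overpartition] demands. *)
Definition block (m : nat) (co : nat * bool) : seq (nat * bool) :=
  nseq co.2 (m, true) ++ nseq co.1 (m, false).

Definition mult (s : seq (nat * bool)) (i : nat) : nat * bool :=
  (count_mem (i, false) s, (i, true) \in s).

Fixpoint opseqs (C : nat -> seq (nat * bool)) (n : nat) : seq (seq (nat * bool)) :=
  if n is n'.+1 then [seq block n co ++ s | co <- C n, s <- opseqs C n']
  else [:: [::]].

Lemma is_overpartition_cons x s : is_overpartition (x :: s) =
  [&& (0 < x.1)%N, all (fun y => (y.1 <= x.1)%N && (y.2 ==> (x.1 != y.1))) s
    & is_overpartition s].
Proof.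
rewrite /is_overpartition /= path_sortedE; last by move=> a b c /= h1 h2; lia.
have -> : all (fun y => (y.1 <= x.1)%N && (y.2 ==> (x.1 != y.1))) s =
    all (fun y => (y.1 <= x.1)%N) s && all (fun y => y.2 ==> (x.1 != y.1)) s.
  by rewrite -all_predI.
rewrite all_map; set b1 := all _ _; set b2 := sorted _ _.
set b3 := all _ _; set b4 := all _ _; set b5 := pairwise _ _.
by case: b1; case: b2; case: b3; case: b4; case: b5; case: (0 < x.1)%N.
Qed.

Lemma mult_out s n : all (fun x => (x.1 <= n)%N) s -> mult s n.+1 = (0%N, false).
Proof.
move=> /allP h; have nin b : (n.+1, b) \notin s.
  by apply/negP => /h /=; rewrite ltnn.
by rewrite /mult (count_memPn (nin _)) (negbTE (nin _)).
Qed.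

Lemma mult_block_cat n co s i :
  mult (block n co ++ s) i =
  if i == n then (co.1 + (mult s i).1, co.2 || (mult s i).2)%N else mult s i.
Proof.
rewrite /mult /block !count_cat !mem_cat !count_nseq !mem_nseq /=.
rewrite !xpair_eqE /= (eq_sym n) ?andbF ?andbT.
by case: eqP => _; case: (co.2); rewrite ?mul0n ?mul1n ?add0n //= ?orbF ?andbF.
Qed.

Lemma is_overpartition_block n co s :
  is_overpartition s -> all (fun x => (x.1 <= n)%N) s ->
  is_overpartition (block n.+1 co ++ s).
Proof.
move=> ops sn; have opf c : is_overpartition (nseq c (n.+1, false) ++ s).
  elim: c => [//|c IH]; rewrite /= is_overpartition_cons IH /= andbT all_cat.
  rewrite all_nseq /= leqnn orbT /=; apply: sub_all sn => -[a b] /= h; lia.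
case: co => c [] /=; last exact: opf.
rewrite /block /= is_overpartition_cons opf /= andbT all_cat.
rewrite all_nseq /= leqnn orbT /=; apply: sub_all sn => -[a b] /= h; lia.
Qed.

(** Sorting puts the copies of [n.+1] in front, and the [pairwise] clause lets only the first of
    them be overlined, so they form a [block]. *)
Lemma overpartition_block n s :
  is_overpartition s -> all (fun x => (x.1 <= n.+1)%N) s ->
  s = block n.+1 (mult s n.+1) ++ [seq x <- s | (x.1 <= n)%N].
Proof.
elim: s => [//|x s IH]; rewrite is_overpartition_cons => /and3P[x0 xs ops].
move=> /= /andP[xn sn]; case: (leqP x.1 n) => xn'.
  have all1 : all (fun y => (y.1 <= n)%N) (x :: s).
    by rewrite /= xn'; apply: sub_all xs => -[a b] /= h; lia.
  rewrite mult_out // /block /=; congr cons; apply/esym/all_filterP.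
  by case/andP: all1.
have x1 : x.1 = n.+1 by lia.
have nin : (n.+1, true) \notin s.
  apply/negP => /(allP xs) /=; rewrite x1 eqxx /=; lia.
have [/= c0 IHs] : (mult s n.+1).2 = false /\ s = block n.+1 (mult s n.+1) ++
  [seq x <- s | (x.1 <= n)%N] by split; [exact: negbTE|exact: IH].
rewrite {1}IHs; case: x x1 {x0 xs xn xn'} => a b /= ->.
rewrite /block /mult /= inE (negbTE nin) !xpair_eqE !eqxx /=.
by case: b.
Qed.

(** Induction on the largest size: [is_overpartition_block] puts its block on, [overpartition_block]
    takes it off, and the other multiplicities do not change. *)
Lemma opseqsP C n s :
  reflect [/\ is_overpartition s, all (fun x => (x.1 <= n)%N) s &
             forall i, (0 < i <= n)%N -> mult s i \in C i]
          (s \in opseqs C n).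
Proof.
elim: n s => [|n IH] s /=.
  rewrite inE; apply: (iffP eqP) => [->|[]]; first by split => // i; lia.
  case: s => // x s /and3P[_ /= + _ + _].
  by move=> /andP[x0 _] /andP[]; lia.
apply: (iffP allpairsP) => [[[co t] /= [coC /IH[opt tn tC] ->]]|[ops sn sC]].
  split; first exact: is_overpartition_block.
    rewrite all_cat /block all_cat !all_nseq /= leqnn !orbT /=.
    by apply: sub_all tn => x; exact: leqW.
  move=> i /andP[i0 ilt]; rewrite mult_block_cat; case: eqP => [->|ni].
    by rewrite mult_out //= addn0 orbF; case: (co) coC.
  by apply: tC; lia.
exists (mult s n.+1, [seq x <- s | (x.1 <= n)%N]); split => /=.
- by apply: sC; rewrite leqnn.
- apply/IH; split; last 2 first.
  + exact: filter_all.
  + move=> i /andP[i0 ilt]; suff -> : mult [seq x <- s | (x.1 <= n)%N] i = mult s i.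
      by apply: sC; lia.
    rewrite {2}(overpartition_block ops sn) mult_block_cat.
    by case: eqP => // ?; lia.
  case/and3P: ops => o1 o2 o3; apply/and3P; split.
  + apply: (subseq_sorted _ _ o1); first by move=> a b c /= h1 h2; lia.
    exact/map_subseq/filter_subseq.
  + by apply/allP => x; rewrite mem_filter => /andP[_ /(allP o2)].
  + exact: (subseq_pairwise (filter_subseq _ _) o3).
- exact: overpartition_block.
Qed.

(** The multiplicity of [n.+1] can be read off the concatenation, so block and remainder are
    determined by it. *)
Lemma opseqs_uniq C n : (forall i, uniq (C i)) -> uniq (opseqs C n).
Proof.
move=> uC; elim: n => [//|n IH] /=; apply: allpairs_uniq => //.
move=> [co s] [co' s'] /allpairsP[[co1 s1] /= [_ /opseqsP[_ h _] [-> ->]]].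
move=> /allpairsP[[co2 s2] /= [_ /opseqsP[_ h' _] [-> ->]]] eqs.
have : co1 = co2.
  have := congr1 (mult^~ n.+1) eqs.
  rewrite !mult_block_cat eqxx !mult_out //= !addn0 !orbF.
  by case: (co1) (co2) => ? ? [].
move=> co12; move: eqs; rewrite co12 => /eqP; rewrite eqseq_cat //.
by rewrite eqxx => /eqP ->.
Qed.

(** Choices at different sizes are independent and the weight is additive over blocks. *)
Lemma sum_opseqs (K : comPzRingType) (q : K) C n :
  \sum_(s <- opseqs C n) q ^+ sumn (map fst s) =
  \prod_(i < n) \sum_(co <- C i.+1) q ^+ (i.+1 * (co.1 + co.2)).
Proof.
elim: n => [|n IH]; first by rewrite big_seq1 big_ord0.
rewrite big_ord_recr /= -IH mulrC big_allpairs_dep /= mulr_suml.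
apply: eq_bigr => co _; rewrite mulr_sumr; apply: eq_bigr => s _.
rewrite map_cat sumn_cat exprD; congr (q ^+ _ * _).
by rewrite /block map_cat sumn_cat !map_nseq !sumn_nseq /= -mulnDr addnC.
Qed.

Lemma eq_mod_form A a m : (0 < a)%N -> (a <= A)%N -> (0 < m)%N ->
  m = a %[mod A] -> exists k, m = (k * A + a)%N.
Proof.
move=> a0 aA m0 ma; have am : (a <= m)%N.
  have [aA'|aA'] := ltnP a A; first by rewrite -(modn_small aA') -ma leq_mod.
  (* In this case the residue class is that of 0, and positivity of [m] makes it a multiple of [A]
     that is at least [A]. *)
  have aE : a = A by lia.
  move: ma; rewrite aE modnn => /eqP; exact: dvdn_leq.
exists ((m - a) %/ A)%N; rewrite divnK ?subnK //.
by rewrite -eqn_mod_dvd //; apply/eqP.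
Qed.

(** * The class of overpartitions with a given [mes] *)

Section Omes.
Variables r A a : nat.
Hypotheses (a_gt0 : (0 < a)%N) (aA : (a <= A)%N) (r_gt1 : (1 < r)%N).

Let A_gt0 : (0 < A)%N. Proof. exact: leq_trans aA. Qed.

Lemma mes_form p : exists k, mes r A a p = (k * A + a)%N.
Proof. by have [/and4P[m0 /eqP ma _ _] _] := mesP a p A_gt0 r_gt1; exact: eq_mod_form. Qed.

Definition choices (m N i : nat) : seq (nat * bool) :=
  if i == m then [seq (c, false) | c <- iota 0 (r - 1)]
  else if (i == a %[mod A]) && (i < m)%N then [:: (0%N, true)]
  else [seq (c, o) | c <- iota 0 N, o <- [:: false; true]].

Lemma choices_uniq m N i : uniq (choices m N i).
Proof.
rewrite /choices; case: ifP => _; last case: ifP => // _.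
  by rewrite map_inj_uniq ?iota_uniq // => x y [].
by apply: allpairs_uniq => //; rewrite ?iota_uniq // => -[? ?] [? ?].
Qed.

(** At a smaller size congruent to [a], membership in the class forbids non-overlined copies. Their
    count 0 is below [r - 1], so minimality of [m] forces an overlined part. Conversely, such an
    overlined part makes every smaller candidate fail [mes_cond]. *)
Lemma Omes_mesE p k : let m := (k * A + a)%N in
  Omes r A a p /\ mes r A a p = m <->
  [/\ (m, true) \notin parts p, (count_mem (m, false) p < r - 1)%N &
      forall i, (0 < i < m)%N -> i = a %[mod A] -> mult p i = (0%N, true)].
Proof.
move=> m; have [cond cmin] := mesP a p A_gt0 r_gt1; split.
  move=> [/allP Op mm]; rewrite mm in cond cmin Op.
  case/and4P: cond => _ _ mp cp; split => // i /andP[i0 im] ia.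
  have nf : (i, false) \notin parts p.
    by apply/negP => /Op /=; rewrite ia eqxx im.
  rewrite /mult (count_memPn nf); congr pair; apply/negPn/negP => nt.
  suff /cmin : mes_cond r A a p i by rewrite leqNgt im.
  by rewrite /mes_cond i0 ia eqxx nt (count_memPn nf) subn_gt0.
move=> [mp cp hi].
have mm : mes r A a p = m.
  apply/eqP; rewrite eqn_leq cmin /=; last first.
    by rewrite /mes_cond mp cp /m modnMDl eqxx addn_gt0 a_gt0 orbT.
  rewrite leqNgt; apply/negP => lt; case/and4P: cond => m0 /eqP ma nt _.
  have := hi _ _ ma; rewrite m0 lt => /(_ isT) [_]; exact/negP.
split=> //; apply/allP => -[i b] ip; rewrite mm /=; apply/implyP => /andP[/eqP ia im].
case: b ip => // ip.
have i0 : (0 < i)%N by case: p ip {cond cmin mp cp hi mm} => s /= /and3P[_ /allP h _] /h.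
have := hi i; rewrite i0 im ia => /(_ isT erefl) [c0 _].
by move: ip; rewrite -has_pred1 has_count c0.
Qed.

(** The index type is a subtype of a subtype, so a raw sequence enters it through two partial
    insertions. *)
Definition Omes_insub (s : seq (nat * bool)) : option {p : overpartition | Omes r A a p} :=
  obind (fun p : overpartition => insub p) (insub s).

Lemma Omes_insubK : ocancel Omes_insub (fun p => parts (val p)).
Proof.
move=> s; rewrite /Omes_insub; case: insubP => //= p _ <-.
by case: insubP => //= u _ ->.
Qed.

Lemma Omes_insub_val p : Omes_insub (parts (val p)) = Some p.
Proof. by rewrite /Omes_insub /= valK /= valK. Qed.

Definition Omes_seq (m N : nat) : seq {p : overpartition | Omes r A a p} :=
  pmap Omes_insub (opseqs (choices m N) N).

Lemma Omes_seq_uniq m N : uniq (Omes_seq m N).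
Proof. by apply: pmap_uniq Omes_insubK _ _; apply: opseqs_uniq => i; exact: choices_uniq. Qed.

(** The bound [m <= N] ensures that [choices] governs every size up to [m], as [Omes_mesE]
    requires. *)
Lemma opseqs_Omes k N s : let m := (k * A + a)%N in (m <= N)%N ->
  s \in opseqs (choices m N) N ->
  exists2 p, Omes_insub s = Some p & mes r A a (val p) = m.
Proof.
move=> m mN /opseqsP[ops _ sC].
have m0 : (0 < m)%N by rewrite addn_gt0 a_gt0 orbT.
pose p := Overpartition ops.
have [Op mm] : Omes r A a p /\ mes r A a p = m.
  apply/Omes_mesE; have := sC m; rewrite m0 mN => /(_ isT).
  rewrite /choices eqxx => /mapP[c]; rewrite mem_iota add0n => cr [cc nt].
  split; [by apply/negbT| by rewrite cc|].
  move=> i /andP[i0 im] ia; have := sC i; rewrite i0 (leq_trans (ltnW im) mN).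
  by move=> /(_ isT); rewrite /choices (ltn_eqF im) ia eqxx im inE => /eqP.
exists (exist _ p Op) => //.
by rewrite -Omes_insub_val.
Qed.

(** The weight bounds every part and the length bounds every multiplicity; this gives the eventual
    membership needed for the exhaustion. *)
Lemma mem_Omes_seq k N p : let m := (k * A + a)%N in
  mes r A a (val p) = m -> (op_weight (val p) + size (val p) < N)%N ->
  p \in Omes_seq m N.
Proof.
move=> m mm wN.
have [] : Omes r A a (val p) /\ mes r A a (val p) = m by split => //; exact: valP.
move=> Op _; have /Omes_mesE [nt cm hi] := conj Op mm.
rewrite /Omes_seq mem_pmap; apply/mapP; exists (parts (val p)); last first.
  by rewrite Omes_insub_val.
apply/opseqsP; split; first by case: (val p).
  apply/allP => x xp; apply: leq_trans (ltnW wN); apply: leq_trans (leq_addr _ _).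
  by rewrite /op_weight sumnE big_map (big_rem _ xp) /= leq_addr.
move=> i /andP[i0 iN]; rewrite /choices; case: eqP => [->|/eqP im].
  by rewrite /mult (negbTE nt); apply/mapP; exists (count_mem (m, false) (parts (val p)));
   rewrite // mem_iota.
case: ifP => [/andP[/eqP ia im']|_]; first by rewrite hi ?inE // i0.
apply/allpairsP; exists (mult (parts (val p)) i); split; last by case: mult.
  rewrite mem_iota /= add0n; apply: leq_ltn_trans wN.
  by rewrite (leq_trans (count_size _ _)) // leq_addl.
by rewrite !inE; case: (mult _ _).2.
Qed.

(** Taking [g] to be the identity serves the sum itself, and taking the norm serves the absolute
    sum. *)
Lemma sum_Omes_seq (K : numFieldType) (q : K) k N (g : K -> K) :
  let m := (k * A + a)%N in (m <= N)%N ->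
  \sum_(p <- Omes_seq m N) g (zmonom (q ^+ op_weight (val p)) (mes r A a (val p)) m) =
  \sum_(s <- opseqs (choices m N) N) g (q ^+ sumn (map fst s)).
Proof.
move=> m mN; rewrite /Omes_seq big_pmap; apply: eq_big_seq => s.
move=> /(opseqs_Omes mN) [p pE mm]; rewrite pE /= /zmonom mm eqxx /op_weight.
by have := Omes_insubK s; rewrite pE /= => ->.
Qed.
End Omes.

(** * The generating function *)

Section generating_function.
Variable K : numFieldType.
Hypothesis prods_cvg : geometric_prods_cvg K.
Variables (r A a : nat) (q : K).
Hypotheses (a_gt0 : (0 < a)%N) (aA : (a <= A)%N) (r_gt1 : (1 < r)%N) (q_lt1 : `|q| < 1).

Let A_gt0 : (0 < A)%N. Proof. exact: leq_trans aA. Qed.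

Let qn_lt1 n : (0 < n)%N -> `|q ^+ n| < 1.
Proof. by case: n => // n _; rewrite normrX exprn_ilt1. Qed.

Let q1B n : (0 < n)%N -> 1 - q ^+ n != 0.
Proof. by move=> /qn_lt1; exact: subr1_neq0. Qed.

Let q1D n : (0 < n)%N -> 1 + q ^+ n != 0.
Proof. by move=> /qn_lt1 h; rewrite -[q ^+ n]opprK; apply: subr1_neq0; rewrite normrN. Qed.

Definition rhs_coef (k : nat) : K :=
  q ^+ (A * 'C(k, 2) + k * a)
    * (qpoch (q ^+ a) (q ^+ A) k / qpoch (- q ^+ a) (q ^+ A) k.+1)
  - q ^+ (A * 'C(k, 2) + k * a + (r - 1) * (k * A + a))
    * (qpoch (q ^+ a) (q ^+ A) k / qpoch (- q ^+ a) (q ^+ A) k.+1).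

Variable k : nat.
Let m := (k * A + a)%N.
Let m_gt0 : (0 < m)%N. Proof. by rewrite addn_gt0 a_gt0 orbT. Qed.

Let special i := (i == a %[mod A]) && (i < m)%N.

(* [1 + defect N i] is the effect of truncating the multiplicities of [i] at [N],
   and [corr i] that of the conditions on sizes congruent to [a], both relative
   to the unrestricted factor [(1 + q ^+ i) / (1 - q ^+ i)]. *)
Let defect (N i : nat) : K := if (i == m) || special i then 0 else - q ^+ (i * N).

Let corr (i : nat) : K :=
  if i == m then (1 - q ^+ ((r - 1) * m)) / (1 + q ^+ m)
  else if special i then q ^+ i * ((1 - q ^+ i) / (1 + q ^+ i)) else 1.

Lemma sum_iota_expr (x : K) n : 1 - x != 0 ->
  \sum_(c <- iota 0 n) x ^+ c = (1 - x ^+ n) / (1 - x).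
Proof.
move=> x1; rewrite -{1}(subn0 n) big_mkord.
by rewrite -opprB subrX1 -mulNr opprB mulrC mulKf.
Qed.

(** The factor is a finite geometric sum at [m], the single power [q ^+ i] at a special size, and
    [1 + q ^+ i] times a geometric sum truncated at [N] elsewhere. *)
Let factorE N i : (0 < i)%N ->
  \sum_(co <- choices r A a m N i) q ^+ (i * (co.1 + co.2)) =
  (1 + q ^+ i) / (1 - q ^+ i) * (1 + defect N i) * corr i.
Proof.
move=> i0; have nB := q1B i0; have nD := q1D i0.
rewrite /choices /defect /corr; case: eqP => [im|_]; rewrite ?orTb ?orFb.
  rewrite big_map /= addr0 mulr1 -im.
  under eq_bigr => c _ do rewrite addn0 exprM.
  by rewrite sum_iota_expr // -exprM mulnC; field; rewrite nD nB.
rewrite -/(special i); case: (special i).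
  by rewrite big_seq1 /= muln1; field; rewrite nD nB.
rewrite big_allpairs_dep /=.
under eq_bigr => c _ do
  rewrite big_cons big_seq1 /= addn0 addn1 mulnS exprD exprM -{1}[q ^+ i ^+ c]mul1r -mulrDl.
rewrite -mulr_sumr sum_iota_expr // -exprM mulr1; field.
exact: nB.
Qed.

(** Each special size contributes to the power of [q] and one factor to each Pochhammer symbol. Size
    [m] contributes the last denominator factor and, through [1 - q ^+ ((r - 1) * m)], the two terms
    of the bracket. *)
Let prod_corr N : (m <= N)%N -> \prod_(i < N) corr i.+1 = rhs_coef k.
Proof.
move=> mN.
have nthpos j : (0 < j * A + a)%N by rewrite addn_gt0 a_gt0 orbT.
(* These are the only sizes at which [corr] can differ from 1. *)
pose t := [seq (j * A + a)%N | j <- iota 0 k.+1].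
have ut : uniq t.
  rewrite map_inj_uniq ?iota_uniq // => i j /addIn /eqP.
  by rewrite eqn_pmul2r // => /eqP.
have st : {subset t <= iota 1 N}.
  move=> x /mapP[j + ->]; rewrite !mem_iota add0n ltnS => /andP[_ jk].
  rewrite nthpos add1n ltnS (leq_trans _ mN) // leq_add2r leq_mul2r jk orbT //.
have -> : \prod_(i < N) corr i.+1 = \prod_(i <- iota 1 N) corr i.
  rewrite -(big_mkord xpredT (fun i => corr i.+1)) /index_iota subn0.
  by rewrite -[iota 1 N]/(iota (1 + 0) N) iotaDl big_map.
rewrite (big_seq_subset _ _ ut (iota_uniq 1 N) st) /= [X in _ * X]big1_seq ?mulr1; last first.
  move=> i /andP[it]; rewrite mem_iota => /andP[i0 _]; rewrite /corr.
  have [im|im] := eqVneq i m.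
    by case/negP: it; apply/mapP; exists k; rewrite // mem_iota add0n ltnS leqnn.
  case: ifP => // /andP[/eqP ia lim]; case/negP: it.
  have [j ij] := eq_mod_form a_gt0 aA i0 ia.
  apply/mapP; exists j => //; rewrite mem_iota add0n ltnS /=.
  by move: lim; rewrite ij /m ltn_add2r ltn_pmul2r // => /ltnW.
rewrite big_map -[iota 0 k.+1]/(index_iota 0 k.+1) big_mkord big_ord_recr /=.
rewrite /rhs_coef !qpochE ?normrN ?qn_lt1 //.
have -> : \prod_(i < k.+1) (1 - - q ^+ a * (q ^+ A) ^+ i) =
    \prod_(i < k) (1 + q ^+ (i * A + a)) * (1 + q ^+ m).
  rewrite big_ord_recr /= /m; congr (_ * _).
    by apply: eq_bigr => i _; rewrite mulNr opprK -exprM -exprD addnC mulnC.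
  by rewrite mulNr opprK -exprM -exprD addnC mulnC.
have -> : \prod_(i < k) (1 - q ^+ a * (q ^+ A) ^+ i) =
    \prod_(i < k) (1 - q ^+ (i * A + a)).
  by apply: eq_bigr => i _; rewrite -exprM -exprD addnC mulnC.
have -> : \prod_(i < k) corr (i * A + a)%N = q ^+ (A * 'C(k, 2) + k * a) *
    (\prod_(i < k) (1 - q ^+ (i * A + a)) / \prod_(i < k) (1 + q ^+ (i * A + a))).
  have -> : (A * 'C(k, 2) + k * a = \sum_(i < k) (i * A + a))%N.
    rewrite big_split /= sum_nat_const card_ord -big_distrl /= mulnC.
    by rewrite -bin2_sum big_mkord.
  rewrite expr_sum -prodf_div -big_split /=; apply: eq_bigr => i _.
  have im : (i * A + a < m)%N by rewrite /m ltn_add2r ltn_pmul2r.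
  by rewrite /corr (ltn_eqF im) /special modnMDl eqxx im.
rewrite /corr eqxx -/m [q ^+ (_ + (r - 1) * m)]exprD.
have Y0 : \prod_(i < k) (1 + q ^+ (i * A + a)) != 0.
  by apply/prodf_neq0 => i _; exact: q1D.
move: (\prod_(i < k) _) Y0 (\prod_(i < k) _) (q ^+ (_ + _)) (q ^+ (_ * m)) (q ^+ m) (q1D m_gt0).
by move=> Y Y0 X u v w w0; field; rewrite w0 Y0.
Qed.

(** Only the unrestricted factors and the defects vary with the index, since [prod_corr] is exact.
    The shift by [m] makes its condition hold at every index. *)
Lemma cvg_sum_opseqs :
  (fun N => \sum_(s <- opseqs (choices r A a m (N + m)) (N + m)) q ^+ sumn (map fst s))
    @ \oo --> qpoch_inf (- q) q / qpoch_inf q q * rhs_coef k.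
Proof.
pose P N : K := \prod_(i < N) (1 - (- q) * q ^+ i) *
  (\prod_(i < N) (1 - q * q ^+ i))^-1 * \prod_(i < N) (1 + defect N i.+1) * rhs_coef k.
have -> : (fun N => \sum_(s <- opseqs (choices r A a m (N + m)) (N + m))
    q ^+ sumn (map fst s)) = (fun N => P (N + m)%N).
  apply/funext => N; rewrite sum_opseqs /P -(prod_corr (leq_addl N m)) -prodfV -!big_split /=.
  by apply: eq_bigr => i _; rewrite factorE // mulNr opprK -exprS.
rewrite (cvg_shiftn m P); apply: cvgM; last exact: cvg_cst.
rewrite -[X in _ --> X]mulr1; apply: cvgM.
  apply: cvgM; first exact: cvg_qpoch_inf.
  by apply: cvgV; [exact: qpoch_inf_neq0 | exact: cvg_qpoch_inf].
apply: (@cvg_prod_near1 _ prods_cvg `|q| (fun N i => defect N i.+1)).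
  by rewrite normr_ge0.
move=> N i N0; rewrite /defect; case: ifP => _.
  by rewrite normr0 mulr_ge0 ?exprn_ge0.
(* The exponent [i.+1 * N] is at least [N + i] because [N] is positive; at [N = 0] the defect would
   be -1. *)
rewrite normrN normrX -exprD ler_wiXn2l ?normr_ge0 ?(ltW q_lt1) //.
by rewrite mulSn leq_add2l leq_pmulr.
Qed.
End generating_function.

(** * Comparison of the coefficients of the two series *)

Section main.
Variable K : numFieldType.
Hypothesis prods_cvg : geometric_prods_cvg K.
Variables (r A a : nat) (q : K).
Hypotheses (a_gt0 : (0 < a)%N) (aA : (a <= A)%N) (r_gt1 : (1 < r)%N) (q_lt1 : `|q| < 1).

Let lhs (p : {p : overpartition | Omes r A a p}) :=
  zmonom (q ^+ op_weight (val p)) (mes r A a (val p)).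
Let rhs (k : nat) := zmonom (rhs_coef r A a q k) (k * A + a).
Let c := qpoch_inf (- q) q / qpoch_inf q q.

(** Norms turn powers of [q] into powers of [|q|], so the absolute sums converge by the same
    counting at [|q|]. *)
Lemma cvg_sum_Omes k :
  summability.partial_sum (fun p => lhs p (k * A + a)%N) @ summability.totally
    --> c * rhs_coef r A a q k.
Proof.
pose m := (k * A + a)%N.
apply: (@cvg_partial_sum_exhaust _ _ _ (fun N => Omes_seq r A a m (N + m)) _
  (qpoch_inf (- `|q|) `|q| / qpoch_inf `|q| `|q| * rhs_coef r A a `|q| k)).
- by move=> N; exact: Omes_seq_uniq.
- move=> p; rewrite /lhs /zmonom; case: ifP => [/eqP/esym mp _|_]; last by rewrite eqxx.
  exists (op_weight (val p) + size (parts (val p))).+1 => // N /= hN.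
  by apply: mem_Omes_seq => //; exact: leq_trans hN (leq_addr _ _).
- under eq_fun => N do rewrite (sum_Omes_seq a_gt0 aA r_gt1 q id (leq_addl N m)).
  exact: cvg_sum_opseqs.
- under eq_fun => N.
    rewrite (sum_Omes_seq a_gt0 aA r_gt1 q (fun x => `|x|) (leq_addl N m)).
    under eq_bigr => s _ do rewrite normrX.
    over.
  by apply: cvg_sum_opseqs => //; rewrite normr_id.
Qed.

(** Both series live on the exponents [k * A + a]. Since [A] is positive, such an exponent
    determines [k], so one term of [rhs] contributes; at other exponents all terms vanish. *)
Lemma zsum_Omes : [/\ zsummable lhs, zsummable rhs & zsum lhs = zscale c (zsum rhs)].
Proof.
have A_gt0 : (0 < A)%N by exact: leq_trans aA.
have H n : exists2 l, summability.partial_sum (fun p => lhs p n) @ summability.totally --> c * l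
    & summability.partial_sum (fun k => rhs k n) @ summability.totally --> l.
  have [[k ->]|nk] := pselect (exists k, n = (k * A + a)%N).
    exists (rhs_coef r A a q k); first exact: cvg_sum_Omes.
    have -> : rhs_coef r A a q k = rhs k (k * A + a)%N by rewrite /rhs /zmonom eqxx.
    apply: cvg_partial_sum1 => j jk; rewrite /rhs /zmonom eqn_add2r eqn_pmul2r //.
    by rewrite eq_sym (negbTE jk).
  exists 0; first rewrite mulr0; apply: cvg_partial_sum0.
    move=> p; rewrite /lhs /zmonom; case: eqP => // np; case: nk; rewrite np.
    exact: mes_form.
  by move=> k; rewrite /rhs /zmonom; case: eqP => // np; case: nk; exists k.
split.
- by move=> n; have [l h _] := H n; apply/cvg_ex; eexists; exact: h.
- by move=> n; have [l _ h] := H n; apply/cvg_ex; eexists; exact: h.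
- apply/funext => n; have [l h1 h2] := H n; rewrite /zscale /zsum /summability.sum.
  by rewrite (cvg_lim (@norm_hausdorff _ K) h1) (cvg_lim (@norm_hausdorff _ K) h2).
Qed.
End main.

Theorem theorem2p11 (R : realType) (A a r : nat) (q : R[i])
    (ha : (1 <= a)%N) (haA : (a <= A)%N) (hr : (2 <= r)%N) (hq : `|q| < 1) :
  let lhs := fun p : {p : overpartition | Omes r A a p} =>
    zmonom (q ^+ op_weight (val p)) (mes r A a (val p)) in
  let rhs := fun k : nat =>
    zmonom
      (q ^+ (A * 'C(k, 2) + k * a)
         * (qpoch (q ^+ a) (q ^+ A) k / qpoch (- q ^+ a) (q ^+ A) k.+1)
       - q ^+ (A * 'C(k, 2) + k * a + (r - 1) * (k * A + a))
         * (qpoch (q ^+ a) (q ^+ A) k / qpoch (- q ^+ a) (q ^+ A) k.+1))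
      (k * A + a) in
  [/\ zsummable lhs, zsummable rhs &
      zsum lhs = zscale (qpoch_inf (- q) q / qpoch_inf q q) (zsum rhs)].
Proof.
move=> lhs rhs.
exact (@zsum_Omes _ (@complex_geometric_prods_cvg R) r A a q ha haA hr hq).
Qed.
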